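(* Let $(\mathfrak g,\mathfrak s,V)$ be a real generic kinematical Lie algebra ($\mathbb K=\mathbb R$) with decomposition $\mathfrak g=\mathcal Z\oplus\mathfrak s\oplus\mathcal P$, $\mathfrak h=\mathcal Z\oplus\mathfrak s$, whose associated iLa $(\mathfrak g,\sigma)$ is indecomposable and non-flat. Then the iLa $(\mathfrak g,\sigma)$ canonically underlies a symplectic iLa $(\mathfrak g,\sigma,\Omega)$, where $\Omega:\mathcal P\times\mathcal P\to\mathfrak h/\mathfrak s\simeq\mathbb R$ is the map $(X,Y)\mapsto[X,Y]+\mathfrak s$.
   Context: An $\mathfrak s$-module $M$ over $\mathbb K$ is absolutely simple if it is simple and the only $\mathbb K$-endomorphisms of $M$ commuting with $\mathfrak s$ are the scalars. For an $\mathfrak s$-module $W$ and an irreducible $\mathfrak s$-module $L$, the weak isotypical component of $L$ in $W$ is the vector sum of all submodules of $W$ isomorphic to $L$; ''empty'' means it is $\{0\}$. A generic kinematical Lie algebra over $\mathbb K$ is a triple $(\mathfrak g,\mathfrak s,V)$ where $\mathfrak g$ is a finite-dimensional Lie algebra over $\mathbb K$; $\mathfrak s$ is a Lie subalgebra of $\mathfrak g$; $V$ is a faithful absolutely simple finite-dimensional $\mathfrak s$-module over $\mathbb K$ such that the weak isotypical component of $V$ in $\Lambda^2(V)$ is empty and the $\mathfrak s$-action preserves a non-degenerate scalar product on $V$ (not necessarily positive definite); and $\mathfrak g=\mathcal Z\oplus\mathfrak s\oplus\mathcal P$ as a vector space, with $\mathcal P$ an $\mathfrak s$-stable subspace isomorphic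 to $V\oplus V$ as $\mathfrak s$-module, and $\mathcal Z$ a line centralizing $\mathfrak s$ in $\mathfrak g$. An iLa (involutive Lie algebra) is a pair $(\mathfrak g,\sigma)$ with $\sigma$ an involutive automorphism of the finite-dimensional Lie algebra $\mathfrak g$; $\mathfrak g=\mathfrak h\oplus\mathcal P$ is its $\pm1$-eigenspace decomposition. A symplectic iLa is a triple $(\mathfrak g,\sigma,\Omega)$ with $(\mathfrak g,\sigma)$ an iLa and $\Omega$ an $\mathfrak h$-invariant non-degenerate skew-symmetric bilinear form on $\mathcal P$. For a generic kinematical Lie algebra, $\sigma:=\mathrm{id}_{\mathcal Z\oplus\mathfrak s}\oplus(-\mathrm{id}_{\mathcal P})$ is an involutive automorphism; $(\mathfrak g,\sigma)$ is the associated iLa. An iLa is flat if $[\mathcal P,\mathcal P]$ centralizes $\mathcal P$, and decomposable if it is isomorphic to a direct sum of two non-trivial iLa's; indecomposable otherwise. *)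

(* Defs.v *)
From HB Require Import structures.
From mathcomp Require Import all_boot all_algebra.
From mathcomp Require Import sesquilinear.

Set Implicit Arguments.
Unset Strict Implicit.
Unset Printing Implicit Defensive.

Import GRing.Theory.
Local Open Scope ring_scope.


HB.mixin Record Vector_isLie (K : fieldType) L of Vector K L := {
  lie : L -> L -> L;
  lie_bilinear : bilinear_for *:%R *:%R lie;
  liexx : forall x, lie x x = 0;
  lie_jacobi : forall x y z,
    lie x (lie y z) + lie y (lie z x) + lie z (lie x y) = 0
}.

#[short(type="lieAlgType")]
HB.structure Definition LieAlgebra (K : fieldType) :=
  {L of Vector K L & Vector_isLie K L}.

Section LieTheory.
Variables (K : fieldType) (g : lieAlgType K).
Implicit Types x y z : g.

Lemma lieDl x y z : lie (x + y) z = lie x z + lie y z.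
Proof. by have := (lie_bilinear.1 z) 1 x y; rewrite /= !scale1r. Qed.

Lemma lieDr x y z : lie z (x + y) = lie z x + lie z y.
Proof. by have := (lie_bilinear.2 z) 1 x y; rewrite /= !scale1r. Qed.

Lemma lie0l z : lie 0 z = 0 :> g.
Proof. by apply: (addrI (lie 0 z)); rewrite -lieDl !addr0. Qed.

Lemma lie0r z : lie z 0 = 0 :> g.
Proof. by apply: (addrI (lie z 0)); rewrite -lieDr !addr0. Qed.

Lemma lieZl a x z : lie (a *: x) z = a *: lie x z.
Proof. by have := (lie_bilinear.1 z) a x 0; rewrite /= !addr0 lie0l addr0. Qed.

Lemma lieZr a x z : lie z (a *: x) = a *: lie z x.
Proof. by have := (lie_bilinear.2 z) a x 0; rewrite /= !addr0 lie0r addr0. Qed.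

Lemma lieC x y : lie x y = - lie y x.
Proof.
have := liexx (x + y); rewrite lieDl !lieDr !liexx add0r addr0 => /eqP.
by rewrite addr_eq0 => /eqP.
Qed.

Lemma lieNr x z : lie z (- x) = - lie z x.
Proof. by rewrite -scaleN1r lieZr scaleN1r. Qed.

Lemma lieNl x z : lie (- x) z = - lie x z.
Proof. by rewrite -scaleN1r lieZl scaleN1r. Qed.

Lemma lie_lieE x y z : lie (lie x y) z = lie x (lie y z) - lie y (lie x z).
Proof.
rewrite lieC; have /eqP := lie_jacobi x y z.
rewrite addr_eq0 => /eqP <-; congr (_ + _).
by rewrite [lie z x]lieC lieNr.
Qed.

Lemma lie_is_linear x : linear (lie x).
Proof. by move=> a y z; rewrite lieDr lieZr. Qed.

HB.instance Definition _ x :=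
  GRing.isLinear.Build K g g *:%R (lie x) (lie_is_linear x).

End LieTheory.

Definition lie_closed (K : fieldType) (g : lieAlgType K) (U : {vspace g}) :=
  forall x y, x \in U -> y \in U -> lie x y \in U.

Record lieSub (K : fieldType) (g : lieAlgType K) := LieSub {
  lsub_vs :> {vspace g};
  lsub_closed : lie_closed lsub_vs
}.

Section SubLie.
Variables (K : fieldType) (g : lieAlgType K) (s : lieSub g).

Definition sub_lie (x y : subvs_of s) : subvs_of s :=
  Subvs (lsub_closed (subvsP x) (subvsP y)).

Lemma sub_lie_bilinear : bilinear_for *:%R *:%R sub_lie.
Proof.
split=> z a x y; apply: subvs_inj; rewrite /=.
  by rewrite lieDl lieZl.
by rewrite lieDr lieZr.
Qed.

Lemma sub_liexx x : sub_lie x x = 0.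
Proof. by apply: subvs_inj; rewrite /= liexx. Qed.

Lemma sub_lie_jacobi x y z :
  sub_lie x (sub_lie y z) + sub_lie y (sub_lie z x) + sub_lie z (sub_lie x y)
  = 0.
Proof. by apply: subvs_inj; rewrite /= lie_jacobi. Qed.

HB.instance Definition _ := Vector_isLie.Build K (subvs_of s)
  sub_lie_bilinear sub_liexx sub_lie_jacobi.

End SubLie.

Section ProdLie.
Variables (K : fieldType) (g1 g2 : lieAlgType K).

Definition prod_lie (x y : g1 * g2) : g1 * g2 := (lie x.1 y.1, lie x.2 y.2).

Lemma prod_lie_bilinear : bilinear_for *:%R *:%R prod_lie.
Proof.
by split=> z a x y; rewrite /prod_lie /= ?(lieDl, lieZl) ?(lieDr, lieZr).
Qed.

Lemma prod_liexx x : prod_lie x x = 0.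
Proof. by rewrite /prod_lie !liexx. Qed.

Lemma prod_lie_jacobi x y z :
  prod_lie x (prod_lie y z) + prod_lie y (prod_lie z x)
  + prod_lie z (prod_lie x y) = 0.
Proof. by congr (_, _); apply: lie_jacobi. Qed.

HB.instance Definition _ := Vector_isLie.Build K (g1 * g2)%type
  prod_lie_bilinear prod_liexx prod_lie_jacobi.

End ProdLie.


Record representation (K : fieldType) (L : lieAlgType K) (V : vectType K) :=
  Rep {
    rep_fun :> 'Hom(L, 'End(V));
    rep_lie : forall x y v,
      rep_fun (lie x y) v =
      rep_fun x (rep_fun y v) - rep_fun y (rep_fun x v)
  }.

Section MakeRep.
Variables (K : fieldType) (L : lieAlgType K) (V : vectType K).
Variable f : L -> V -> V.
Hypothesis f_bilinear : bilinear_for *:%R *:%R f.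
Hypothesis f_lie : forall x y v, f (lie x y) v = f x (f y v) - f y (f x v).

Definition mk_rep1 (x : L) : {linear V -> V} :=
  HB.pack (f x) (GRing.isLinear.Build K V V *:%R (f x) (f_bilinear.2 x)).

Lemma mk_rep1_is_linear : linear (fun x => linfun (mk_rep1 x)).
Proof.
move=> a x y; apply/lfunP=> v; rewrite add_lfunE scale_lfunE.
by rewrite (lfunE (mk_rep1 _)) !(lfunE (mk_rep1 _)); apply: (f_bilinear.1 v).
Qed.

Definition mk_rep2 : {linear L -> 'End(V)} :=
  HB.pack (fun x => linfun (mk_rep1 x))
    (GRing.isLinear.Build K L 'End(V) *:%R _ mk_rep1_is_linear).

Lemma mk_repP x v : linfun mk_rep2 x v = f x v.
Proof. by rewrite (lfunE mk_rep2) /= (lfunE (mk_rep1 x)). Qed.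

Lemma mk_rep_lie x y v :
  linfun mk_rep2 (lie x y) v =
  linfun mk_rep2 x (linfun mk_rep2 y v) - linfun mk_rep2 y (linfun mk_rep2 x v).
Proof. by rewrite !mk_repP f_lie. Qed.

Definition mk_rep : representation L V := Rep mk_rep_lie.

Lemma mk_repE x v : mk_rep x v = f x v.
Proof. exact: mk_repP. Qed.

End MakeRep.

Section Modules.
Variables (K : fieldType) (L : lieAlgType K).

Section OneModule.
Variables (V : vectType K) (rho : representation L V).

Definition submodule (U : {vspace V}) := forall x, (rho x @: U <= U)%VS.

Definition faithful := lker (rep_fun rho) = 0%VS.

Definition simple_module :=
  ({:V} != 0)%VS /\ forall U, submodule U -> U = 0%VS \/ U = fullv.

Definition absolutely_simple :=
  simple_module /\
  forall f : 'End(V), (forall x, (f \o rho x)%VF = (rho x \o f)%VF) ->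
    exists a, f = a *: \1%VF.

Definition invariant_scalar_product (B : {bilinear V -> V -> K^o}) :=
  [/\ forall v w, B v w = B w v,
      forall v, (forall w, B v w = 0) -> v = 0 &
      forall x v w, B (rho x v) w + B v (rho x w) = 0].

End OneModule.

Definition module_iso_to_subspace (V W : vectType K)
    (rho : representation L V) (tau : representation L W) (U : {vspace W}) :=
  exists f : 'Hom(V, W),
    [/\ lker f = 0%VS, limg f = U &
        forall x v, f (rho x v) = tau x (f v)].

(* Membership in the (possibly infinite) sum of all the submodules of W that
   are isomorphic to V. *)
Definition in_weak_isotypical (V W : vectType K)
    (rho : representation L V) (tau : representation L W) (w : W) :=
  exists Us : seq {vspace W},
    (forall U, U \in Us -> submodule tau U /\ module_iso_to_subspace rho tau U)
    /\ w \in (\sum_(U <- Us) U)%VS.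

Definition weak_isotypical_empty (V W : vectType K)
    (rho : representation L V) (tau : representation L W) :=
  forall w, in_weak_isotypical rho tau w -> w = 0.

Section DirectSum.
Variables (V W : vectType K).
Variables (rho : representation L V) (tau : representation L W).

Definition sum_act (x : L) (v : V * W) : V * W := (rho x v.1, tau x v.2).

Lemma sum_act_bilinear : bilinear_for *:%R *:%R sum_act.
Proof.
split=> z a x y; rewrite /sum_act /=; last by rewrite !linearP.
by rewrite !linearP /= !add_lfunE !scale_lfunE.
Qed.

Lemma sum_act_lie x y v :
  sum_act (lie x y) v = sum_act x (sum_act y v) - sum_act y (sum_act x v).
Proof. by rewrite /sum_act !rep_lie. Qed.

Definition sum_rep : representation L (V * W)%type :=
  mk_rep sum_act_bilinear sum_act_lie.

End DirectSum.

End Modules.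

Section Adjoint.
Variables (K : fieldType) (g : lieAlgType K) (s : lieSub g).

Definition ad_act (x : subvs_of s) (y : g) : g := lie (vsval x) y.

Lemma ad_act_bilinear : bilinear_for *:%R *:%R ad_act.
Proof.
split=> z a x y; rewrite /ad_act; last by rewrite lieDr lieZr.
by rewrite linearP lieDl lieZl.
Qed.

Lemma ad_act_lie x y v :
  ad_act (lie x y) v = ad_act x (ad_act y v) - ad_act y (ad_act x v).
Proof. exact: lie_lieE. Qed.

Definition ad_rep : representation (subvs_of s) g :=
  mk_rep ad_act_bilinear ad_act_lie.

End Adjoint.

(** The exterior square of V: V (x) V is identified with 'Hom(V^*, V), v (x) w
    being f |-> f(v) w, and Lambda^2 V is the subspace spanned by the
    v /\ w := v (x) w - w (x) v.  See [ext2_universal]. *)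

Section ExteriorSquare.
Variables (K : fieldType) (V : vectType K).

Local Notation dual := 'Hom(V, K^o).
Local Notation tensors := 'Hom(dual, V).

Definition tens_fun (v w : V) (f : dual) : V := (f v : K) *: w.
Lemma tens_fun_is_linear v w : linear (tens_fun v w).
Proof.
by move=> a f h; rewrite /tens_fun add_lfunE scale_lfunE scalerDl scalerA.
Qed.
HB.instance Definition _ v w :=
  GRing.isLinear.Build K dual V *:%R (tens_fun v w) (tens_fun_is_linear v w).

Definition tens (v w : V) : tensors := linfun (tens_fun v w).

Lemma tensE v w f : tens v w f = (f v : K) *: w.
Proof. by rewrite lfunE. Qed.

Definition wedge_tens (v w : V) : tensors := tens v w - tens w v.

Lemma wedge_tensE v w f : wedge_tens v w f = (f v : K) *: w - (f w : K) *: v.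
Proof. by rewrite add_lfunE opp_lfunE !tensE. Qed.

Lemma wedge_tens_bilinear : bilinear_for *:%R *:%R wedge_tens.
Proof.
have wl z : linear (wedge_tens^~ z).
  move=> a x y; apply/lfunP=> f.
  rewrite [RHS]add_lfunE [X in _ = X + _]scale_lfunE !wedge_tensE linearP /=.
  rewrite scalerDl scalerDr scalerBr -!scalerA opprD addrACA.
  by rewrite !scalerA (mulrC a (f z : K)).
split=> z; first exact: wl.
have wC v w : wedge_tens v w = - wedge_tens w v by rewrite [RHS]opprB.
by move=> a x y; rewrite /= !(wC z) wl /= opprD scalerN.
Qed.

Definition ext2_vs : {vspace tensors} :=
  <<[seq wedge_tens v w | v <- vbasis {:V}, w <- vbasis {:V}]>>%VS.

Definition ext2 : vectType K := subvs_of ext2_vs.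

Lemma mem_wedge v w : wedge_tens v w \in ext2_vs.
Proof.
rewrite (coord_vbasis (memvf v)) (coord_vbasis (memvf w)).
pose b := (vbasis {:V}).
have wsumr u n (c : 'I_n -> K) (e : 'I_n -> V) :
    wedge_tens u (\sum_i c i *: e i) = \sum_i c i *: wedge_tens u (e i).
  apply: (big_rec2 (fun p q => wedge_tens u p = q)).
    by apply/lfunP=> f; rewrite wedge_tensE zero_lfunE scaler0 (linear0 f)
      scale0r subr0.
  by move=> i p q _ <-; exact: (wedge_tens_bilinear.2 u).
have wsuml u n (c : 'I_n -> K) (e : 'I_n -> V) :
    wedge_tens (\sum_i c i *: e i) u = \sum_i c i *: wedge_tens (e i) u.
  apply: (big_rec2 (fun p q => wedge_tens p u = q)).
    by apply/lfunP=> f; rewrite wedge_tensE zero_lfunE scaler0 (linear0 f)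
      scale0r subr0.
  by move=> i p q _ <-; exact: (wedge_tens_bilinear.1 u).
rewrite wsuml memv_suml // => i _; rewrite rpredZ //.
rewrite wsumr memv_suml // => j _; rewrite rpredZ //.
by apply/memv_span/allpairs_f; rewrite mem_nth ?size_tuple.
Qed.

Definition wedge (v w : V) : ext2 := Subvs (mem_wedge v w).

Lemma wedge_bilinear : bilinear_for *:%R *:%R wedge.
Proof.
split=> z a x y; apply: subvs_inj; rewrite linearP.
  exact: (wedge_tens_bilinear.1 z).
exact: (wedge_tens_bilinear.2 z).
Qed.

Lemma wedgexx v : wedge v v = 0.
Proof. by apply: subvs_inj; rewrite /= /wedge_tens subrr. Qed.

End ExteriorSquare.

Section Ext2Universal.
Variables (K : fieldType) (V W : vectType K) (b : V -> V -> W).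
Hypothesis b_bilinear : bilinear_for *:%R *:%R b.
Hypothesis b_alt : forall v, b v v = 0.

Let n := \dim {:V}.
Let e := vbasis {:V}.

Let bl v w u a : b (a *: v + w) u = a *: b v u + b w u.
Proof. exact: (b_bilinear.1 u). Qed.
Let br v w u a : b u (a *: v + w) = a *: b u v + b u w.
Proof. exact: (b_bilinear.2 u). Qed.
Let b0l u : b 0 u = 0.
Proof. by have := bl 0 0 u (-1); rewrite !scaler0 addr0 scaleN1r addNr. Qed.
Let b0r u : b u 0 = 0.
Proof. by have := br 0 0 u (-1); rewrite !scaler0 addr0 scaleN1r addNr. Qed.
Let bC v w : b v w = - b w v.
Proof.
apply/eqP; rewrite -addr_eq0; have := b_alt (1 *: v + w).
by rewrite bl !br !b_alt !scale1r add0r addr0 => ->.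
Qed.

Let cf (i : 'I_n) : 'Hom(V, K^o) := linfun (coord e i : V -> K^o).

Let Ffun (T : ext2 V) : W :=
  \sum_(i < n) \sum_(j < n | (i < j)%N) (cf j (vsval T (cf i)) : K) *: b e`_i e`_j.

Let Ffun_linear : linear Ffun.
Proof.
move=> a S T; rewrite /Ffun scaler_sumr -big_split /=; apply: eq_bigr => i _.
rewrite scaler_sumr -big_split /=; apply: eq_bigr => j _.
by rewrite add_lfunE scale_lfunE linearP scalerDl scalerA.
Qed.

Let b_expand v w :
  b v w = \sum_(i < n) \sum_(j < n) (coord e i v * coord e j w) *: b e`_i e`_j.
Proof.
rewrite {1}(coord_vbasis (memvf v)) -/e.
rewrite (_ : b _ w = \sum_i coord e i v *: b e`_i w); last first.
  apply: (big_rec2 (fun p q => b p w = q)) => [|i p q _ <-]; first exact: b0l.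
  exact: bl.
apply: eq_bigr => i _; rewrite {1}(coord_vbasis (memvf w)) -/e.
rewrite (_ : b _ _ = \sum_j coord e j w *: b e`_i e`_j); last first.
  apply: (big_rec2 (fun p q => b _ p = q)) => [|j p q _ <-]; first exact: b0r.
  exact: br.
by rewrite scaler_sumr; apply: eq_bigr => j _; rewrite scalerA.
Qed.

Let Ffun_wedge v w : Ffun (wedge v w) = b v w.
Proof.
rewrite b_expand /Ffun.
have E i j : (cf j (vsval (wedge v w) (cf i)) : K)
    = coord e i v * coord e j w - coord e i w * coord e j v.
  by rewrite /= wedge_tensE linearB !linearZ /= !lfunE /= scalerN.
transitivity (\sum_(i < n) (\sum_(j < n | (i < j)%N)
     (coord e i v * coord e j w) *: b e`_i e`_j
   - \sum_(j < n | (i < j)%N) (coord e i w * coord e j v) *: b e`_i e`_j)).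
  apply: eq_bigr => i _; rewrite -sumrB; apply: eq_bigr => j _.
  by rewrite E scalerBl.
transitivity (\sum_(i < n) (\sum_(j < n | (i < j)%N)
     (coord e i v * coord e j w) *: b e`_i e`_j
   + \sum_(j < n | (j < i)%N) (coord e i v * coord e j w) *: b e`_i e`_j));
  last first.
  apply: eq_bigr => i _; rewrite [RHS](bigID (fun j : 'I_n => (i < j)%N)) /=.
  congr (_ + _); rewrite [RHS](bigD1 i) ?ltnn //= b_alt scaler0 add0r.
  by apply: eq_bigl => j; rewrite ltn_neqAle -leqNgt andbC.
rewrite sumrB big_split /=; congr (_ + _).
rewrite (exchange_big_dep predT) //= -sumrN; apply: eq_bigr => j _.
rewrite -sumrN; apply: eq_bigr => i _.
by rewrite [in RHS]bC scalerN mulrC.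
Qed.

Lemma ext2_universal :
  exists! F : 'Hom(ext2 V, W), forall v w, F (wedge v w) = b v w.
Proof.
pose lin := GRing.isLinear.Build K (ext2 V) W *:%R Ffun Ffun_linear.
pose F0 : {linear ext2 V -> W} := HB.pack Ffun lin.
have F0E v w : linfun F0 (wedge v w) = b v w.
  by rewrite lfunE; apply: Ffun_wedge.
exists (linfun F0); split=> [//|F' F'E].
apply/lfunP=> -[T HT].
have: (HT : T \in _) = HT by [].
have [H|] := boolP (T \in (linfun (vsval : ext2 V -> _) @:
  lker (linfun F0 - F'))%VS).
  case/memv_imgP: H => S; rewrite memv_ker add_lfunE opp_lfunE subr_eq0.
  move=> /eqP FS; rewrite lfunE /= => TE _.
  by rewrite (_ : Subvs HT = S) //; apply: subvs_inj.
case/negP; apply: (subvP _ _ HT); apply/span_subvP => _ /allpairsP[[v w]] /= [_ _ ->].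
rewrite (_ : wedge_tens v w = linfun (vsval : ext2 V -> _) (wedge v w)).
  apply: memv_img; rewrite memv_ker add_lfunE opp_lfunE F'E.
  by rewrite F0E subrr.
by rewrite lfunE.
Qed.

End Ext2Universal.

Section Ext2Rep.
Variables (K : fieldType) (L : lieAlgType K) (V : vectType K).
Variable rho : representation L V.

Local Notation dual := 'Hom(V, K^o).
Local Notation tensors := 'Hom(dual, V).

Definition dual_fun (x : L) (f : dual) : dual := (f \o rho x)%VF.
Lemma dual_fun_is_linear x : linear (dual_fun x).
Proof. by move=> a f h; rewrite /dual_fun comp_lfunDl comp_lfunZl. Qed.
HB.instance Definition _ x :=
  GRing.isLinear.Build K dual dual *:%R (dual_fun x) (dual_fun_is_linear x).

(* x . (v (x) w) = (x v) (x) w + v (x) (x w) *)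
Definition tens_act (x : L) (T : tensors) : tensors :=
  (rho x \o T)%VF + (T \o linfun (dual_fun x))%VF.

Lemma tens_actE x T f :
  tens_act x T f = rho x (T f) + T (f \o rho x)%VF.
Proof. by rewrite /tens_act add_lfunE !comp_lfunE lfunE. Qed.

Lemma tens_act_bilinear : bilinear_for *:%R *:%R tens_act.
Proof.
split=> [T|x] a y z; apply/lfunP=> f /=;
  rewrite [RHS]add_lfunE [X in _ = X + _]scale_lfunE !tens_actE scalerDr.
  rewrite linearP add_lfunE scale_lfunE /= addrACA; congr (_ + _).
  rewrite -[RHS]linearP; congr (fun_of_lfun T _).
  by apply/lfunP=> v; rewrite !(add_lfunE, scale_lfunE, comp_lfunE) linearP.
by rewrite !add_lfunE !scale_lfunE linearP addrACA.
Qed.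

Lemma tens_act_wedge x v w :
  tens_act x (wedge_tens v w) = wedge_tens (rho x v) w + wedge_tens v (rho x w).
Proof.
apply/lfunP=> f; rewrite [RHS]add_lfunE tens_actE !wedge_tensE linearB !linearZ /=.
by rewrite !comp_lfunE addrACA [RHS]addrACA; congr (_ + _); apply: addrC.
Qed.

Lemma tens_act_lie x y T :
  tens_act (lie x y) T =
  tens_act x (tens_act y T) - tens_act y (tens_act x T).
Proof.
apply/lfunP=> f; rewrite [RHS]add_lfunE opp_lfunE !tens_actE rep_lie.
have -> : (f \o rho (lie x y))%VF =
      (f \o rho x \o rho y)%VF - (f \o rho y \o rho x)%VF.
  apply/lfunP=> v; rewrite add_lfunE opp_lfunE !comp_lfunE rep_lie.
  exact: linearB.
rewrite linearB /= !linearD /=.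
rewrite [X in _ = _ + X]addrACA [RHS]addrACA; congr (_ + _).
  by rewrite [X in _ = _ + X]addrC addrA addrK.
by rewrite [X in _ = X + _]addrC addrA addrK.
Qed.

Lemma tens_act_ext2 x T : T \in ext2_vs V -> tens_act x T \in ext2_vs V.
Proof.
pose A := linfun (mk_rep1 tens_act_bilinear x).
suff sub : (ext2_vs V <= A @^-1: ext2_vs V)%VS.
  by move/(subvP sub); rewrite -memv_preim lfunE.
apply/span_subvP => _ /allpairsP[[v w]] /= [_ _ ->].
by rewrite -memv_preim lfunE /= tens_act_wedge memvD ?mem_wedge.
Qed.

Definition ext2_act (x : L) (w : ext2 V) : ext2 V :=
  Subvs (tens_act_ext2 x (subvsP w)).

Lemma ext2_act_bilinear : bilinear_for *:%R *:%R ext2_act.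
Proof.
split=> [w|x] a y z; apply: subvs_inj => /=.
  exact: (tens_act_bilinear.1 (vsval w)).
exact: (tens_act_bilinear.2 x).
Qed.

Lemma ext2_act_lie x y w :
  ext2_act (lie x y) w = ext2_act x (ext2_act y w) - ext2_act y (ext2_act x w).
Proof. by apply: subvs_inj; apply: tens_act_lie. Qed.

Definition ext2_rep : representation L (ext2 V) :=
  mk_rep ext2_act_bilinear ext2_act_lie.

Lemma ext2_rep_wedge x v w :
  ext2_rep x (wedge v w) = wedge (rho x v) w + wedge v (rho x w).
Proof. by rewrite mk_repE; apply: subvs_inj; apply: tens_act_wedge. Qed.

End Ext2Rep.


Record iLa (K : fieldType) (g : lieAlgType K) := ILa {
  ila_sigma :> 'End(g);
  ila_morph : forall x y,
    ila_sigma (lie x y) = lie (ila_sigma x) (ila_sigma y);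
  ila_invol : forall x, ila_sigma (ila_sigma x) = x
}.

Section ILa.
Variable K : fieldType.

(* The eigenspaces of sigma for the eigenvalues 1 and -1. *)
Definition ila_plus (g : lieAlgType K) (I : iLa g) : {vspace g} :=
  lker (ila_sigma I - \1)%VF.
Definition ila_minus (g : lieAlgType K) (I : iLa g) : {vspace g} :=
  lker (ila_sigma I + \1)%VF.

Lemma mem_ila_plus (g : lieAlgType K) (I : iLa g) x :
  (x \in ila_plus I) = (I x == x).
Proof. by rewrite memv_ker add_lfunE opp_lfunE id_lfunE subr_eq0. Qed.

Lemma mem_ila_minus (g : lieAlgType K) (I : iLa g) x :
  (x \in ila_minus I) = (I x == - x).
Proof. by rewrite memv_ker add_lfunE id_lfunE addr_eq0. Qed.

Lemma lie_plus_minus (g : lieAlgType K) (I : iLa g) x y :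
  x \in ila_plus I -> y \in ila_minus I -> lie x y \in ila_minus I.
Proof.
rewrite mem_ila_plus !mem_ila_minus ila_morph => /eqP-> /eqP->.
by rewrite lieNr.
Qed.

Definition ila_iso (g g' : lieAlgType K) (I : iLa g) (I' : iLa g') :=
  exists f : 'Hom(g, g'),
    [/\ lker f = 0%VS, limg f = fullv,
        forall x y, f (lie x y) = lie (f x) (f y) &
        forall x, f (I x) = I' (f x)].

Section Sum.
Variables (g1 g2 : lieAlgType K) (I1 : iLa g1) (I2 : iLa g2).

Definition sum_sigma (x : g1 * g2) : g1 * g2 := (I1 x.1, I2 x.2).
Lemma sum_sigma_is_linear : linear sum_sigma.
Proof. by move=> a x y; rewrite /sum_sigma /= !linearP. Qed.
HB.instance Definition _ :=
  GRing.isLinear.Build K (g1 * g2)%type (g1 * g2)%type *:%R sum_sigma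
    sum_sigma_is_linear.

Lemma sum_sigma_morph x y :
  linfun sum_sigma (lie x y) = lie (linfun sum_sigma x) (linfun sum_sigma y).
Proof. by rewrite !lfunE /= /sum_sigma /= !ila_morph. Qed.

Lemma sum_sigma_invol x : linfun sum_sigma (linfun sum_sigma x) = x.
Proof. by rewrite !lfunE /= /sum_sigma /= !ila_invol; case: x. Qed.

Definition ila_sum : iLa (g1 * g2)%type := ILa sum_sigma_morph sum_sigma_invol.

End Sum.

Definition nontrivial (g : lieAlgType K) := ({:g} != 0)%VS.

Definition decomposable (g : lieAlgType K) (I : iLa g) :=
  exists (g1 g2 : lieAlgType K) (I1 : iLa g1) (I2 : iLa g2),
    [/\ nontrivial g1, nontrivial g2 & ila_iso I (ila_sum I1 I2)].

Definition indecomposable (g : lieAlgType K) (I : iLa g) := ~ decomposable I.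

Definition flat (g : lieAlgType K) (I : iLa g) :=
  forall x y z, x \in ila_minus I -> y \in ila_minus I -> z \in ila_minus I ->
    lie (lie x y) z = 0.

(* [vsproj] is the inverse of [vsval] here, by [lie_plus_minus]. *)
Record symplectic_iLa (g : lieAlgType K) (I : iLa g)
    (Omega : subvs_of (ila_minus I) -> subvs_of (ila_minus I) -> K^o) : Prop :=
  SymplecticILa {
    sympl_bilinear : bilinear_for *:%R *:%R Omega;
    sympl_skew : forall X Y, Omega X Y = - Omega Y X;
    sympl_nondegenerate : forall X, (forall Y, Omega X Y = 0) -> X = 0;
    sympl_invariant : forall h X Y, h \in ila_plus I ->
      Omega (vsproj _ (lie h (vsval X))) Y
      + Omega X (vsproj _ (lie h (vsval Y))) = 0
  }.

End ILa.

Arguments symplectic_iLa {K g} I Omega.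


Section Quotient.
Variables (K : fieldType) (V : vectType K) (U : {vspace V}).

(* V / U, realized on a complement of U; [quot_class] is V -> V / U. *)
Definition quotv : vectType K := subvs_of U^C.

Definition quot_fun (v : V) : quotv := Subvs (memv_pi U^C U v).
Lemma quot_fun_is_linear : linear quot_fun.
Proof. by move=> a x y; apply: subvs_inj; rewrite /= linearP. Qed.
HB.instance Definition _ :=
  GRing.isLinear.Build K V quotv *:%R quot_fun quot_fun_is_linear.

Definition quot_class : 'Hom(V, quotv) := linfun quot_fun.

Lemma quot_classE v : vsval (quot_class v) = daddv_pi U^C U v.
Proof. by rewrite lfunE. Qed.

Let capCv : (U^C :&: U = 0)%VS. Proof. by rewrite capvC capv_compl. Qed.

Lemma lker_quot_class : lker quot_class = U.
Proof.
apply/vspaceP=> v; rewrite memv_ker -(inj_eq (@subvs_inj _ _ _)) quot_classE.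
have := daddv_pi_add capCv (w := v); rewrite addvC addv_complf memvf.
move=> /(_ isT) vE; apply/eqP/idP => [v0|vU].
  by rewrite -vE v0 add0r memv_pi.
apply: (addIr (daddv_pi U U^C v)); rewrite vE /= add0r.
by rewrite daddv_pi_id ?capv_compl.
Qed.

Lemma limg_quot_class : limg quot_class = fullv.
Proof.
apply/vspaceP=> w; rewrite memvf.
rewrite (_ : w = quot_class (vsval w)) ?memv_img ?memvf //.
by apply: subvs_inj; rewrite quot_classE daddv_pi_id // subvsP.
Qed.

End Quotient.

Definition linear_iso (K : fieldType) (V W : vectType K) (f : 'Hom(V, W)) :=
  lker f = 0%VS /\ limg f = fullv.


Section Kinematical.
Variables (K : fieldType) (g : lieAlgType K) (s : lieSub g).

Record generic_kinematical (V : vectType K)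
    (rho : representation (subvs_of s) V) (Z P : {vspace g}) : Prop :=
  GenericKinematical {
    kin_faithful : faithful rho;
    kin_absolutely_simple : absolutely_simple rho;
    kin_isotypical : weak_isotypical_empty rho (ext2_rep rho);
    kin_scalar_product :
      exists B : {bilinear V -> V -> K^o}, invariant_scalar_product rho B;
    kin_direct : directv (Z + s + P);
    kin_full : (Z + s + P)%VS = fullv;
    kin_P_stable : submodule (ad_rep s) P;
    kin_P_iso : module_iso_to_subspace (sum_rep rho rho) (ad_rep s) P;
    kin_Z_line : \dim Z = 1%N;
    kin_Z_central : forall z x, z \in Z -> x \in s -> lie z x = 0
  }.

Definition kin_h (Z : {vspace g}) : {vspace g} := (Z + s)%VS.

(* id on Z + s and - id on P *)
Definition kin_involution (Z P : {vspace g}) : 'End(g) :=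
  daddv_pi (kin_h Z) P - daddv_pi P (kin_h Z).

(* h / s for h := Z + s, s being seen as a subspace of h *)
Definition kin_s_in_h (Z : {vspace g}) : {vspace subvs_of (kin_h Z)} :=
  (linfun (vsval : subvs_of (kin_h Z) -> g) @^-1: s)%VS.
Definition kin_h_mod_s (Z : {vspace g}) : vectType K := quotv (kin_s_in_h Z).

(* [X, Y] + s; meaningful when [X, Y] lies in h. *)
Definition kin_Omega (Z : {vspace g}) (X Y : g) : kin_h_mod_s Z :=
  quot_class (kin_s_in_h Z) (vsproj (kin_h Z) (lie X Y)).

Lemma kin_involutionE (Z P : {vspace g}) : directv (Z + s + P) ->
  {in kin_h Z, forall x, kin_involution Z P x = x} /\
  {in P, forall x, kin_involution Z P x = - x}.
Proof.
rewrite directvE /= => /eqP dim_sum.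
have capHP : (kin_h Z :&: P = 0)%VS.
  apply/eqP; rewrite -dimv_eq0 -leqn0 -(leq_add2l (\dim (kin_h Z + P))).
  by rewrite dimv_sum_cap addn0 dim_sum leq_add2r dimv_add_leqif.
have capPH : (P :&: kin_h Z = 0)%VS by rewrite capvC.
have h0 U W x : (U :&: W = 0)%VS -> x \in U -> daddv_pi W U x = 0 :> g.
  move=> UW xU; have WU : (W :&: U = 0)%VS by rewrite capvC.
  have /(daddv_pi_add WU) : (x \in W + U)%VS.
    by rewrite (subvP (addvSr W U)).
  by rewrite (daddv_pi_id UW xU) => /(canRL (addrK _)); rewrite subrr.
split=> x xU; rewrite add_lfunE opp_lfunE.
  by rewrite (daddv_pi_id capHP xU) (h0 _ _ _ capHP xU) subr0.
by rewrite (daddv_pi_id capPH xU) (h0 _ _ _ capPH xU) add0r.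
Qed.

End Kinematical.

(* Main.v *)
Require Import Defs.
From mathcomp Require Import all_boot all_algebra reals.
From HB Require Import structures.
From mathcomp Require Import sesquilinear.

Set Implicit Arguments.
Unset Strict Implicit.
Unset Printing Implicit Defensive.

Import GRing.Theory Num.Theory.
Local Open Scope ring_scope.

(* Write P = V (x) K^2 and let B be the invariant scalar product on V.  As V is
   absolutely simple, the component of [P, P] along h / s is a multiple of
   B (x) det: nonzero multiples are nondegenerate.  If it vanishes, then [P, P]
   lies in s, and the Jacobi identity on P leaves only the brackets
   [v (x) e_1, w (x) e_2], acting on V by operators F v w which are B-skew and
   such that F v w u is symmetric in v and u; such an F is zero, so [P, P] = 0
   by faithfulness and the iLa is flat.  Invariance is the Jacobi identity
   together with [h, h] contained in s. *)

(** * Preliminaries on signs and bilinear maps *)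

Lemma self_opp_eq0 (K : fieldType) (W : lmodType K) (x : W) :
  (2 : K) != 0 -> x = - x -> x = 0.
Proof.
move=> char2 /eqP; rewrite -addr_eq0 -mulr2n -scaler_nat scaler_eq0.
by rewrite (negPf char2) => /eqP.
Qed.

(** Currying makes kernels, images and inverses of linear maps available for forms. *)
Lemma bilinear_lfun (K : fieldType) (U V W : vectType K) (b : U -> V -> W) :
  bilinear_for *:%R *:%R b ->
  exists F : 'Hom(U, 'Hom(V, W)), forall u v, F u v = b u v.
Proof.
move=> [bl br].
pose b1 u : {linear V -> W} :=
  HB.pack (b u) (GRing.isLinear.Build K V W *:%R (b u) (br u)).
have b2_linear : linear (fun u => linfun (b1 u)).
  move=> a x y; apply/lfunP=> v; rewrite add_lfunE scale_lfunE.
  by rewrite !(lfunE (b1 _)); apply: (bl v).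
pose b2 : {linear U -> 'Hom(V, W)} := HB.pack (fun u => linfun (b1 u))
  (GRing.isLinear.Build K U 'Hom(V, W) *:%R _ b2_linear).
by exists (linfun b2) => u v; rewrite (lfunE b2) (lfunE (b1 u)).
Qed.

Lemma bilinear_forP (K : fieldType) (V : vectType K)
    (B : {bilinear V -> V -> K^o}) : bilinear_for *:%R *:%R B.
Proof.
by split=> [w|v] a x y; [exact: linearPl | exact: linearPr].
Qed.

(** * Invariant forms and the vanishing of the curvature *)

Section InvariantForms.
Variables (K : fieldType) (L : lieAlgType K) (V : vectType K).
Variables (rho : representation L V) (B : {bilinear V -> V -> K^o}).
Hypothesis B_inv : invariant_scalar_product rho B.

Lemma scalar_product_inj u v : (forall w, B u w = B v w) -> u = v.
Proof.
case: B_inv => _ B_nd _ uv; apply/eqP; rewrite -subr_eq0; apply/eqP/B_nd => w.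
by rewrite linearBl uv subrr.
Qed.

(* Schur's lemma applied to B^-1 b. *)
Lemma invariant_form_scalar (b : V -> V -> K^o) :
  absolutely_simple rho -> bilinear_for *:%R *:%R b ->
  (forall x v w, b (rho x v) w + b v (rho x w) = 0) ->
  exists a : K, forall v w, b v w = a * B v w.
Proof.
move=> [_ schur] b_bil b_inv.
have [F FE] := bilinear_lfun (bilinear_forP B).
have [G GE] := bilinear_lfun b_bil.
(* [F] maps V to its dual; it is injective by nondegeneracy of [B], hence bijective by equality of
   dimensions, and [T] is F^-1 G. *)
have F_inj : lker F == 0%VS.
  apply/lker0P => u v uv; apply: scalar_product_inj => w.
  by rewrite -!FE uv.
have F_surj : limg F = fullv.
  apply/eqP; rewrite eqEdim subvf limg_dim_eq ?(eqP F_inj) ?capv0 //.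
  by rewrite !dimvf /= [dim 'Hom(_, _)]muln1.
have [T TE] : exists T : 'End(V), forall v w, B (T v) w = b v w.
  exists (F^-1 \o G)%VF => v w.
  by rewrite -FE comp_lfunE limg_lfunVK ?F_surj ?memvf.
(* [T] commutes with [rho x]: moving [rho x] across [b] and across [B] costs the same sign. *)
have [x|a Ta] := schur T.
  apply/lfunP => v; rewrite !comp_lfunE; apply: scalar_product_inj => w.
  case: B_inv => _ _ Binv.
  rewrite TE; have /eqP := b_inv x v w; have /eqP := Binv x (T v) w.
  by rewrite !addr_eq0 => /eqP-> /eqP->; rewrite TE.
exists a => v w; rewrite -TE Ta scale_lfunE id_lfunE.
by have := linearPl B w a v 0; rewrite addr0 linear0l addr0.
Qed.

(* B (F a b c) d is symmetric under (a c) and skew under (c d), hence both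
   symmetric and skew under (a d) = (c d)(a c)(c d) = (a c)(c d)(a c). *)
Lemma symmetric_skew_eq0 (F : V -> V -> V -> V) : (2 : K) != 0 ->
  (forall u v w, F u v w = F w v u) ->
  (forall u v w x, B (F u v w) x + B w (F u v x) = 0) ->
  forall u v w, F u v w = 0.
Proof.
case: B_inv => B_sym B_nd _ char2 F_sym F_skew a b c; apply: B_nd => d.
have skew u v w x : B (F u v w) x = - B (F u v x) w.
  by apply/eqP; rewrite -addr_eq0 (B_sym _ w) F_skew.
apply: (self_opp_eq0 char2).
by rewrite {1}skew F_sym skew opprK F_sym skew F_sym.
Qed.

(* The Jacobi identity for [v (x) e_i, w (x) e_i, u (x) e_j], i <> j, has
   components [v (x) e_i, w (x) e_i].u = 0 along e_j and, along e_i,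
   [v (x) e_i, u (x) e_j].w = [w (x) e_i, u (x) e_j].v. *)
Lemma curvature_eq0 (R : V * V -> V * V -> L) :
  (2 : K) != 0 -> faithful rho ->
  (forall p q, R p q = - R q p) ->
  (forall p p' q, R (p + p') q = R p q + R p' q) ->
  (forall p q r, sum_rep rho rho (R p q) r + sum_rep rho rho (R q r) p
                 + sum_rep rho rho (R r p) q = 0) ->
  forall p q, R p q = 0.
Proof.
move=> char2 /eqP/lker0P rho_inj R_skew RDl bianchi.
have rho_eq0 x : (forall v, rho x v = 0) -> x = 0.
  move=> x0; apply: rho_inj; rewrite linear0; apply/lfunP => v.
  by rewrite x0 zero_lfunE.
have [_ _ Binv] := B_inv.
have bianchi1 p q r :
    rho (R p q) r.1 + rho (R q r) p.1 + rho (R r p) q.1 = 0.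
  by have := congr1 fst (bianchi p q r); rewrite !mk_repE.
have bianchi2 p q r :
    rho (R p q) r.2 + rho (R q r) p.2 + rho (R r p) q.2 = 0.
  by have := congr1 snd (bianchi p q r); rewrite !mk_repE.
have R11 v w : R (v, 0) (w, 0) = 0.
  apply: rho_eq0 => u.
  by have := bianchi2 (v, 0) (w, 0) (0, u); rewrite /= !linear0 !addr0.
have R22 v w : R (0, v) (0, w) = 0.
  apply: rho_eq0 => u.
  by have := bianchi1 (0, v) (0, w) (u, 0); rewrite /= !linear0 !addr0.
have R12 v w : R (v, 0) (0, w) = 0.
  apply: rho_eq0 => u.
  pose F a b c := rho (R (a, 0) (0, b)) c.
  rewrite -[LHS]/(F v w u); apply: symmetric_skew_eq0 => // [a b c|a b c d].
    have := bianchi1 (a, 0) (c, 0) (0, b).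
    rewrite /= linear0 add0r [R (0, b) _]R_skew linearN opp_lfunE.
    by move/eqP; rewrite subr_eq0 => /eqP.
  exact: Binv.
have R21 v w : R (0, v) (w, 0) = 0 by rewrite R_skew R12 oppr0.
move=> [p1 p2] [q1 q2].
have split (u v : V) : (u, v) = (u, 0) + (0, v).
  by congr (_, _); rewrite ?addr0 ?add0r.
(* Additivity in the second argument comes from [R_skew] and [RDl]. *)
rewrite (split p1) (split q1) RDl !(R_skew _ (_ + _)) !RDl.
by rewrite R11 R12 R21 R22 !addr0 oppr0 addr0.
Qed.

End InvariantForms.

(** * The splitting h + P and the line h / s *)

Section Kinematical.
Variables (K : fieldType) (g : lieAlgType K) (s : lieSub g) (V : vectType K).
Variables (rho : representation (subvs_of s) V) (Z P : {vspace g}).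
Variable (I : iLa g).
Hypothesis char2 : (2 : K) != 0.
Hypothesis kin : generic_kinematical rho Z P.
Hypothesis I_kin : ila_sigma I = kin_involution s Z P.

Lemma kin_h_fix : {in kin_h s Z, forall x, I x = x}.
Proof. by rewrite I_kin; case: (kin_involutionE (kin_direct kin)). Qed.

Lemma kin_P_opp : {in P, forall x, I x = - x}.
Proof. by rewrite I_kin; case: (kin_involutionE (kin_direct kin)). Qed.

Lemma kin_split x : exists h p, [/\ h \in kin_h s Z, p \in P & x = h + p].
Proof.
have : x \in (kin_h s Z + P)%VS by rewrite /kin_h (kin_full kin) memvf.
by case/memv_addP => h hh [p pP ->]; exists h, p.
Qed.

(** The h-component of a vector negated by [I] equals its own opposite, hence vanishes outside
    characteristic 2. *)
Lemma ila_minus_kin : ila_minus I = P.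
Proof.
apply/vspaceP => x; rewrite mem_ila_minus; apply/eqP/idP => [|/kin_P_opp //].
have [h [p [hh pP ->]]] := kin_split x.
rewrite linearD /= (kin_h_fix hh) (kin_P_opp pP) opprD.
move=> /addIr/(self_opp_eq0 char2)->.
by rewrite add0r.
Qed.

Lemma ila_plus_kin : ila_plus I = kin_h s Z.
Proof.
apply/vspaceP => x; rewrite mem_ila_plus; apply/eqP/idP => [|/kin_h_fix //].
have [h [p [hh pP ->]]] := kin_split x.
rewrite linearD /= (kin_h_fix hh) (kin_P_opp pP).
move=> /addrI/esym/(self_opp_eq0 char2)->.
by rewrite addr0.
Qed.

(** [I] is a morphism, so the signs of the two factors cancel. *)
Lemma lie_PP x y : x \in P -> y \in P -> lie x y \in kin_h s Z.
Proof.
move=> xP yP; rewrite -ila_plus_kin mem_ila_plus ila_morph.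
by rewrite !kin_P_opp // lieNl lieNr opprK.
Qed.

(** A line is abelian and [Z] commutes with [s], so only brackets inside [s] survive. *)
Lemma lie_hh x y : x \in kin_h s Z -> y \in kin_h s Z -> lie x y \in s.
Proof.
have Z_line : (Z = <[vpick Z]>)%VS.
  apply/esym/eqP; rewrite eqEdim -memvE memv_pick dim_vline vpick0 -dimv_eq0.
  by rewrite (kin_Z_line kin).
case/memv_addP => z zZ [a aS ->] /memv_addP[z' z'Z [b bS ->]].
have -> : lie (z + a) (z' + b) = lie a b.
  rewrite lieDl !lieDr (kin_Z_central kin zZ bS) (lieC a z').
  rewrite (kin_Z_central kin z'Z aS) oppr0 addr0 add0r.
  move: zZ z'Z; rewrite Z_line => /vlineP[c ->] /vlineP[c' ->].
  by rewrite lieZl lieZr liexx !scaler0 add0r.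
exact: lsub_closed.
Qed.

Lemma kin_class_eq0 x : x \in kin_h s Z ->
  (quot_class (kin_s_in_h s Z) (vsproj (kin_h s Z) x) == 0) = (x \in lsub_vs s).
Proof.
by move=> xh; rewrite -memv_ker lker_quot_class -memv_preim lfunE /= vsprojK.
Qed.

Lemma dim_kin_h_mod_s : \dim {:kin_h_mod_s s Z} = 1%N.
Proof.
pose i := linfun (vsval : subvs_of (kin_h s Z) -> g).
have i_inj : lker i == 0%VS.
  by apply/lker0P => x y; rewrite !lfunE => /subvs_inj.
have s_dim : \dim (kin_s_in_h s Z) = \dim s.
  rewrite -(limg_dim_eq (f := i)); last by rewrite (eqP i_inj) capv0.
  rewrite lpreimK //; apply/subvP => x xs.
  have xh : x \in kin_h s Z by apply: (subvP (addvSr Z s)).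
  by rewrite -(vsprojK xh) -[vsval _](lfunE vsval) memv_img ?memvf.
have h_dim : \dim (kin_h s Z) = (1 + \dim s)%N.
  have := kin_direct kin; rewrite directvE /= => /eqP dim_sum.
  apply/eqP; rewrite -(kin_Z_line kin) eqn_leq dimv_add_leqif /=.
  (* Adding [P] to both sides reduces the reverse inequality to subadditivity for (Z + s) + P. *)
  rewrite -(leq_add2r (\dim P)) -dim_sum.
  exact: dimv_add_leqif.
have := limg_ker_dim (quot_class (kin_s_in_h s Z)) fullv.
rewrite capfv lker_quot_class limg_quot_class s_dim (dimvf (subvs_of _)).
by rewrite /dim /= h_dim addnC => /addIn.
Qed.

Lemma kin_h_mod_s_iso :
  exists theta : 'Hom(kin_h_mod_s s Z, K^o), linear_iso theta.
Proof.
have dim1 := dim_kin_h_mod_s.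
have [f f_iso] : exists f : 'Hom(kin_h_mod_s s Z, K^o), lker f = 0%VS.
  (* [i0] is the only index, so this one coordinate determines a vector. *)
  pose i0 := cast_ord (esym dim1) ord0.
  exists (linfun (coord (vbasis {:kin_h_mod_s s Z}) i0 : _ -> K^o)).
  apply/eqP/lker0P => x y; rewrite !lfunE /= => xy.
  rewrite (coord_vbasis (memvf x)) (coord_vbasis (memvf y)).
  apply: eq_bigr => j _; congr (_ *: _).
  suff -> : j = i0 by [].
  by apply: val_inj; case: j => [] [|j] //=; rewrite dim1.
exists f; split=> //; apply/eqP.
rewrite eqEdim subvf limg_dim_eq ?f_iso ?capv0 //.
by rewrite dim1 dimvf.
Qed.

(** * The bracket modulo s as a scalar form *)

Section Omega.
Variable theta : 'Hom(kin_h_mod_s s Z, K^o).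
Hypothesis theta_iso : linear_iso theta.

Definition omega (X Y : g) : K^o := theta (kin_Omega s Z X Y).

Lemma omega_bilinear : bilinear_for *:%R *:%R omega.
Proof.
split=> z a x y; rewrite /omega /kin_Omega.
  by rewrite lieDl lieZl !linearP.
by rewrite lieDr lieZr !linearP.
Qed.

Lemma omega_skew X Y : omega X Y = - omega Y X.
Proof. by rewrite /omega /kin_Omega lieC !linearN. Qed.

Lemma omega_eq0 X Y : X \in P -> Y \in P ->
  (omega X Y == 0) = (lie X Y \in lsub_vs s).
Proof.
move=> XP YP; rewrite /omega -memv_ker (proj1 theta_iso) memv0.
by rewrite kin_class_eq0 // lie_PP.
Qed.

Lemma omega_invariant h X Y : h \in kin_h s Z -> X \in P -> Y \in P ->
  omega (lie h X) Y + omega X (lie h Y) = 0.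
Proof.
move=> hh XP YP.
have -> : omega (lie h X) Y + omega X (lie h Y)
    = theta (quot_class _ (vsproj (kin_h s Z) (lie h (lie X Y)))).
  have -> : lie h (lie X Y) = lie (lie h X) Y + lie X (lie h Y).
    by rewrite lie_lieE subrK.
  by rewrite !linearD.
have hXY := lie_hh hh (lie_PP XP YP).
apply/eqP; rewrite -memv_ker (proj1 theta_iso) memv0 kin_class_eq0 //.
by rewrite (subvP (addvSr Z s)).
Qed.

(** * The form in coordinates V + V on P, and its nondegeneracy *)

Variable f : 'Hom((V * V)%type, g).
Hypothesis f_inj : lker f = 0%VS.
Hypothesis f_img : limg f = P.
Hypothesis f_mod : forall x v, f (sum_rep rho rho x v) = ad_rep s x (f v).

Lemma f_P p : f p \in P. Proof. by rewrite -f_img memv_img ?memvf. Qed.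

Lemma f_act x p : lie (vsval x) (f p) = f (rho x p.1, rho x p.2).
Proof. by have := f_mod x p; rewrite !mk_repE. Qed.

(* Invariant bilinear forms on P = V (x) K^2 are the B (x) c; skewness of
   omega and symmetry of B make c a multiple of the determinant. *)
Lemma omega_det (B : {bilinear V -> V -> K^o}) :
  invariant_scalar_product rho B ->
  exists a : K, forall p q,
    omega (f p) (f q) = a * ((B p.1 q.2 : K) - B p.2 q.1).
Proof.
move=> B_inv; have [B_sym _ _] := B_inv.
(* Pulling [omega] back along two equivariant maps from V gives an invariant form on V. *)
have form_scalar (i j : V -> V * V) : linear i -> linear j ->
    (forall x v, i (rho x v) = (rho x (i v).1, rho x (i v).2)) ->
    (forall x v, j (rho x v) = (rho x (j v).1, rho x (j v).2)) ->
    exists a : K, forall v w, omega (f (i v)) (f (j w)) = a * B v w.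
  move=> i_lin j_lin i_mod j_mod.
  apply: (invariant_form_scalar (b := fun v w => omega (f (i v)) (f (j w)))
    B_inv (kin_absolutely_simple kin)).
    split=> z a x y; rewrite ?i_lin ?j_lin linearP.
      exact: omega_bilinear.1.
    exact: omega_bilinear.2.
  move=> x v w; rewrite i_mod j_mod -!f_act omega_invariant ?f_P //.
  by rewrite (subvP (addvSr Z s)) // subvsP.
pose e1 (v : V) : V * V := (v, 0); pose e2 (v : V) : V * V := (0, v).
have e1_lin : linear e1.
  by move=> a u v; congr (_, _); rewrite /= ?scaler0 ?addr0.
have e2_lin : linear e2.
  by move=> a u v; congr (_, _); rewrite /= ?scaler0 ?addr0.
have e1_mod x v : e1 (rho x v) = (rho x (e1 v).1, rho x (e1 v).2).
  by rewrite /= linear0.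
have e2_mod x v : e2 (rho x v) = (rho x (e2 v).1, rho x (e2 v).2).
  by rewrite /= linear0.
(* On a single copy of V the form is both skew and a multiple of the symmetric [B]. *)
have diag0 i : linear i ->
    (forall x v, i (rho x v) = (rho x (i v).1, rho x (i v).2)) ->
    forall v w, omega (f (i v)) (f (i w)) = 0.
  move=> i_lin i_mod v w.
  have [c cE] := form_scalar _ _ i_lin i_lin i_mod i_mod.
  by apply: (self_opp_eq0 char2); rewrite {1}omega_skew !cE B_sym.
have [a aE] := form_scalar _ _ e1_lin e2_lin e1_mod e2_mod.
exists a => p q.
have split (r : V * V) : f r = f (e1 r.1) + f (e2 r.2).
  rewrite -linearD; congr (f _).
  by case: r => u v; congr (_, _); rewrite ?addr0 ?add0r.
have omegaDl X Y W : omega (X + Y) W = omega X W + omega Y W.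
  by have := omega_bilinear.1 W 1 X Y; rewrite /= !scale1r.
have omegaDr X Y W : omega W (X + Y) = omega W X + omega W Y.
  by have := omega_bilinear.2 W 1 X Y; rewrite /= !scale1r.
rewrite (split p) (split q) omegaDl !omegaDr !diag0 // add0r addr0 aE.
by rewrite (omega_skew (f (e2 _))) aE (B_sym q.1) mulrBr.
Qed.

(** The brackets land in [s], which acts on both copies of V through [rho], so [curvature_eq0]
    applies. *)
Lemma lie_PP_eq0 (B : {bilinear V -> V -> K^o}) :
  invariant_scalar_product rho B ->
  (forall p q, omega (f p) (f q) = 0) -> forall p q, lie (f p) (f q) = 0.
Proof.
move=> B_inv omega0.
have lie_s p q : lie (f p) (f q) \in lsub_vs s.
  by rewrite -omega_eq0 ?f_P // omega0.
pose R p q : subvs_of s := vsproj s (lie (f p) (f q)).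
have RE p q : vsval (R p q) = lie (f p) (f q) by rewrite vsprojK.
suff R0 p q : R p q = 0 by move=> p q; rewrite -RE R0.
apply: (curvature_eq0 B_inv char2 (kin_faithful kin))
  => {p q} [p q|p p' q|p q r].
- by apply: subvs_inj; rewrite linearN /= !RE lieC.
- by apply: subvs_inj; rewrite linearD /= !RE linearD lieDl.
(* Under the injective [f] the cyclic sum becomes, up to sign, the Jacobi identity in [g]. *)
apply: (lker0P (introT eqP f_inj)); rewrite !linearD linear0 /= !f_mod !mk_repE.
rewrite /ad_act !RE 3!(lieC (lie _ _)) -!opprD.
by rewrite -addrA addrC lie_jacobi oppr0.
Qed.

Lemma omega_nondegenerate (B : {bilinear V -> V -> K^o}) :
  invariant_scalar_product rho B -> ~ flat I ->
  forall X, X \in P -> (forall Y, Y \in P -> omega X Y = 0) -> X = 0.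
Proof.
move=> B_inv nflat; have [a aE] := omega_det B_inv.
have [a0|a_neq0] := eqVneq a 0.
  case: nflat => X Y W; rewrite ila_minus_kin -f_img.
  case/memv_imgP=> p _ -> /memv_imgP[q _ ->] _.
  by rewrite (lie_PP_eq0 B_inv) ?lie0l // => u v; rewrite aE a0 mul0r.
move=> X; rewrite -f_img => /memv_imgP[[p1 p2] _ ->] X_rad.
have B0 q : (B p1 q.2 : K) - B p2 q.1 = 0.
  have := X_rad (f q) (memv_img f (memvf q)); rewrite aE => /eqP.
  by rewrite mulf_eq0 (negPf a_neq0) => /eqP.
have [_ B_nd _] := B_inv.
(* Testing against each copy of V separately isolates one component of the radical vector. *)
have -> : p1 = 0.
  by apply: B_nd => w; have := B0 (0, w); rewrite /= linear0r subr0.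
have -> : p2 = 0.
  apply: B_nd => w; have := B0 (w, 0); rewrite /= linear0r sub0r.
  by move/eqP; rewrite oppr_eq0 => /eqP.
exact: linear0.
Qed.

End Omega.
End Kinematical.

Theorem proposition3p3 (R : realType) (g : lieAlgType R) (s : lieSub g)
    (V : vectType R) (rho : representation (subvs_of s) V)
    (Z P : {vspace g}) (I : iLa g) :
  generic_kinematical rho Z P ->
  ila_sigma I = kin_involution s Z P ->
  indecomposable I ->
  ~ flat I ->
  [/\ forall X Y : g, X \in P -> Y \in P -> lie X Y \in kin_h s Z,
      exists theta : 'Hom(kin_h_mod_s s Z, R^o), linear_iso theta &
      forall theta : 'Hom(kin_h_mod_s s Z, R^o), linear_iso theta ->
        symplectic_iLa I
          (fun X Y => theta (kin_Omega s Z (vsval X) (vsval Y)))].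
Proof.
move=> kin I_kin _ nflat.
have char2 : (2 : R) != 0 by rewrite pnatr_eq0.
have minusE := ila_minus_kin char2 kin I_kin.
have plusE := ila_plus_kin char2 kin I_kin.
have mP (X : subvs_of (ila_minus I)) : vsval X \in P by rewrite -minusE subvsP.
split.
- exact: lie_PP kin I_kin.
- exact: kin_h_mod_s_iso kin.
move=> theta theta_iso.
have [f [f_inj f_img f_mod]] := kin_P_iso kin.
have [B B_inv] := kin_scalar_product kin.
split.
- split=> z a x y; rewrite linearP; first exact: (omega_bilinear theta).1.
  exact: (omega_bilinear theta).2.
- by move=> X Y; apply: omega_skew.
- move=> X X_rad; apply: subvs_inj.
  apply: (omega_nondegenerate char2 kin I_kin theta_iso f_inj f_img f_mod
    B_inv nflat) => // Y YP.
  have Ym : Y \in ila_minus I by rewrite minusE.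
  by rewrite -(vsprojK Ym); apply: X_rad.
(* Bracketing with h preserves the -1 eigenspace, so [vsproj] loses nothing. *)
move=> h X Y hp; rewrite !vsprojK ?lie_plus_minus ?subvsP //.
by apply: (omega_invariant char2 kin I_kin theta_iso); rewrite -?plusE ?mP.
Qed.
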